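(* Let $M\ge 1$ be an integer and let $\tau>0$, $P_0>0$, $\bar{P}>0$, $R_0>0$. Let $|h_0|^2,|h_1|^2,\dots,|h_M|^2$ be independent random variables, each exponentially distributed with mean $1$, and let $|h_{(1)}|^2\le\cdots\le|h_{(M)}|^2$ denote the order statistics of $|h_1|^2,\dots,|h_M|^2$. Let $N$ be the (random) number of indices $m\in\{1,\dots,M\}$ with $|h_m|^2<\tau$ (so the admitted users have gains $|h_{(1)}|^2,\dots,|h_{(N)}|^2$). Define the outage probability $$\mathbb{P}_0^{\mathrm{I,OL}}=\mathbb{P}\left(\log_2\left(1+\frac{|h_0|^2P_0}{\sum_{j=1}^{N}|h_{(j)}|^2\bar{P}+1}\right)<R_0\right),$$ where the empty sum (case $N=0$) equals $0$. Then, with $\epsilon_0=2^{R_0}-1$, \begin{align*} \mathbb{P}_0^{\mathrm{I,OL}} =& \sum_{n=1}^{M}\frac{M!}{n!(M-n)!}e^{-(M-n)\tau}\left(1-e^{-\tau}\right)^n \sum_{p=0}^{n} \frac{\binom{n}{p}(-1)^pe^{-p\tau}}{(1-e^{-\tau})^n}\left( \sum_{l=0}^{n-1} \frac{\epsilon_0P_0^{-1}\bar{P}\,e^{-\epsilon_0P_0^{-1}(1+\bar{P}p\tau)}}{(1+\epsilon_0P_0^{-1}\bar{P})^{l+1}} + e^{-\epsilon_0P_0^{-1}}-e^{-\epsilon_0P_0^{-1}(1+\bar{P}p\tau)}\right)\\ &+\left(1-e^{-\epsilon_0P_0^{-1}}\right). \end{align*}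
   Context: Uplink semi-grant-free NOMA model: a grant-based user $\mathrm{U}_0$ with channel $h_0$ and transmit SNR $P_0$, and $M$ grant-free users with channels $h_m$ and common transmit SNR $\bar{P}$; all channels are i.i.d. Rayleigh fading, so the channel gains $|h_m|^2$ are i.i.d. exponential with mean 1, and noise power is normalized to 1. In the ''Type I open-loop'' protocol the base station broadcasts a threshold $\tau$ and exactly the grant-free users whose channel gain is below $\tau$ transmit; the base station decodes $\mathrm{U}_0$'s signal first in successive interference cancellation, treating all admitted grant-free users' signals as interference, and $\mathrm{U}_0$ is in outage if its achievable rate is below its target rate $R_0$. *)

(* Defs.v *)
From HB Require Import structures.
From mathcomp Require Import all_boot all_order all_algebra.
From mathcomp Require Import all_classical all_reals all_analysis.
Set Implicit Arguments. Unset Strict Implicit. Unset Printing Implicit Defensive.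
Import Order.TTheory GRing.Theory Num.Theory.
Local Open Scope classical_set_scope.
Local Open Scope ring_scope.

(* Mutual independence of a finite family of real random variables:
   the joint law of (X_i)_i is the product of the marginals on every
   family of Borel sets (taking B_i = setT recovers all subfamilies). *)
Definition mutually_independent d (T : measurableType d) (R : realType)
    (P : probability T R) (n : nat) (X : 'I_n -> {RV P >-> R}) : Prop :=
  forall B : 'I_n -> set R, (forall i, measurable (B i)) ->
    P (\bigcap_(i in [set: 'I_n]) (X i @^-1` B i)) =
    (\prod_(i < n) P (X i @^-1` B i))%E.

Definition log2 (R : realType) (x : R) : R := ln x / ln 2.

Definition order_stats (R : realType) (n : nat) (x : 'I_n -> R) : seq R :=
  sort <=%R [seq x i | i <- enum 'I_n].

Definition num_below (R : realType) (n : nat) (tau : R) (x : 'I_n -> R) : nat :=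
  #|[set i : 'I_n | x i < tau]|.

Definition admitted_interference (R : realType) (n : nat) (tau Pbar : R)
    (x : 'I_n -> R) : R :=
  \sum_(j < num_below tau x) nth 0 (order_stats x) j * Pbar.

(* Main.v *)
Require Import Defs.
From HB Require Import structures.
From mathcomp Require Import all_boot all_order all_algebra.
From mathcomp Require Import all_classical all_reals all_analysis.
From mathcomp Require Import measurable_realfun ring lra.
Set Implicit Arguments.
Unset Strict Implicit.
Unset Printing Implicit Defensive.
Import Order.TTheory GRing.Theory Num.Theory.
Local Open Scope classical_set_scope.
Local Open Scope ring_scope.

(* Put c = a Pbar. The order statistics below tau are a rearrangement of the
   gains below tau, so up to a null set the outage event is
   h_0 < a + sum_m f(h_m), where f(x) = c x on [0, tau[ and f(x) = 0 elsewhere.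
   Memorylessness makes the sum tractable: if P(X >= t) = K e^(-t) for all
   t >= 0 and Y is independent of X, then X - f(Y) has the tail
   K E[e^(-f(Y))] e^(-t). Absorbing the M users one by one into h_0, the
   complementary event has probability e^(-a) L^M with
   L = E[e^(-f(h))] = (1 - e^(-(1+c)tau)) / (1 + c) + e^(-tau), and expanding
   L^M according to the number n of admitted users gives the double sum. *)

(** * Rewriting the interference and the outage inequality *)

(** In the sorted list the gains below [tau] form the prefix of length [num_below], so [nth] never
    returns its default and a permutation restores the original indices. *)
Lemma admitted_interferenceE (R : realType) (n : nat) (tau Pbar : R)
    (x : 'I_n -> R) :
  admitted_interference tau Pbar x = \sum_(i < n | x i < tau) x i * Pbar.
Proof.
rewrite /admitted_interference /order_stats.
set s := [seq x i | i <- enum 'I_n].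
have ss : sorted <=%R (sort <=%R s) by exact: sort_le_sorted.
have -> : num_below tau x = count (< tau) (sort <=%R s).
  rewrite count_sort count_map /num_below -sum1_card -sum1_count big_enum_cond.
  by apply: eq_bigl => i /=; apply/idP/idP => [/set_mem|/mem_set].
transitivity (\sum_(y <- take (count (< tau) (sort <=%R s)) (sort <=%R s))
    y * Pbar).
  rewrite (big_nth 0) size_takel ?count_size// big_mkord.
  by apply: eq_bigr => i _; rewrite nth_take.
rewrite -sorted_filter_lt// big_filter (perm_big s) ?perm_sort//=.
by rewrite /s big_map big_enum_cond.
Qed.

Lemma measurable_invr (R : realType) : measurable_fun [set: R] (@GRing.inv R).
Proof.
(* Real powers are measurable, and the exponent -1 gives the inverse on nonnegative reals, including
   0; oddness covers the negative ones. *)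
have -> : @GRing.inv R =
    (fun x => if 0 <= x then x `^ (- 1) else - ((- x) `^ (- 1))).
  apply/funext => x; case: ifPn => [x0|]; first by rewrite powR_inv1.
  by rewrite -ltNge => x0; rewrite powR_inv1 ?invrN ?opprK// oppr_ge0 ltW.
apply: measurable_fun_ifT; first exact: measurable_fun_ler.
- exact: measurable_powR.
- apply: measurable_funN.
  exact: (@measurableT_comp _ _ _ _ _ _ (@powR R ^~ (- 1))).
Qed.

Lemma log2_lt (R : realType) (y r : R) : 0 < r -> (log2 y < r) = (y < 2 `^ r).
Proof.
move=> r0; rewrite /log2 ltr_pdivrMr ?ln_gt0 ?ltr1n//.
(* [ln] is 0 at nonpositive arguments, so there both inequalities are true. *)
have [y0|y0] := leP y 0.
  rewrite ln0// mulr_gt0 ?ln_gt0 ?ltr1n//.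
  by rewrite (le_lt_trans y0) ?powR_gt0.
by rewrite -ln_powR ltr_ln// posrE powR_gt0.
Qed.

Lemma log2_snr_lt (R : realType) (x y P0 R0 : R) : 0 < P0 -> 0 < R0 -> 0 <= y ->
  (log2 (1 + x * P0 / (y + 1)) < R0) = (x < (2 `^ R0 - 1) / P0 * (y + 1)).
Proof.
move=> P00 R00 y0; rewrite log2_lt// -ltrBrDl ltr_pdivrMr ?ltr_wpDl//.
by rewrite mulrAC -ltr_pdivlMr.
Qed.

(** * Mutual independence and joint laws *)

Lemma bigcap_ord_recl (T : Type) (n : nat) (F : 'I_n.+1 -> set T) :
  \bigcap_(i in [set: 'I_n.+1]) F i =
  F ord0 `&` \bigcap_(i in [set: 'I_n]) F (lift ord0 i).
Proof.
apply/seteqP; split => [x Fx|x [F0 Fx] i _].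
  by split => [|i _]; exact: Fx.
by case: (unliftP ord0 i) => [j ->|->] //; exact: Fx.
Qed.

(** Extends factorization from rectangles to all Borel sets of the plane by uniqueness of the
    product measure. [E] stands for the constraints on the remaining variables. *)
Lemma joint_law_restr (d : measure_display) (T : measurableType d)
    (R : realType) (P : probability T R) (X Y : {RV P >-> R}) (E : set T) :
  measurable E ->
  (forall A B, measurable A -> measurable B ->
    P ((X @^-1` A `&` Y @^-1` B) `&` E) =
    P (X @^-1` A) * P (Y @^-1` B) * P E)%E ->
  forall D : set (R * R), measurable D ->
  P ([set w | D (X w, Y w)] `&` E) =
  ((distribution P X \x distribution P Y) D * P E)%E.
Proof.
move=> mE XYE D mD.
have mXY : measurable_fun [set: T] (fun w => (X w, Y w)).
  exact: measurable_fun_pair.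
(* Rescaling by the inverse of [P E] requires a nonzero value; otherwise both sides vanish. *)
have [E0|E0] := eqVneq (P E) 0%E.
  rewrite E0 mule0; apply: subset_measure0 E0 => //.
  by apply: measurableI => //; rewrite -[X in measurable X]setTI; exact: mXY.
have PEfin : P E \is a fin_num by exact: fin_num_measure.
have k0 : 0 <= (fine (P E))^-1 by rewrite invr_ge0 fine_ge0.
have PEK : ((fine (P E))^-1%:E * P E)%E = 1%E.
  by rewrite -[X in (_ * X)%E]fineK// -EFinM mulVf// fine_eq0.
(* P restricted to E and rescaled by 1 / P(E) agrees with the product law on
   rectangles. *)
pose mXY' := isMeasurableFun.Build _ _ _ _ _ mXY.
pose XY : {mfun T >-> (R * R)%type} := HB.pack (fun w => (X w, Y w)) mXY'.
have := @product_measure_unique _ _ _ _ _ (distribution P X) (distribution P Y)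
  (mscale (NngNum k0) (pushforward (mrestr P mE) XY)) _ D mD.
move=> ->.
  transitivity (((fine (P E))^-1%:E * P E) *
                P ([set w | D (X w, Y w)] `&` E))%E; first by rewrite PEK mul1e.
  by rewrite muleAC.
move=> A B mA mB.
transitivity ((fine (P E))^-1%:E * P ((X @^-1` A `&` Y @^-1` B) `&` E))%E => //.
by rewrite XYE// muleCA PEK mule1.
Qed.

Lemma joint_law01_restr (d : measure_display) (T : measurableType d)
    (R : realType) (P : probability T R) (n : nat)
    (X : 'I_n.+2 -> {RV P >-> R}) (B : 'I_n -> set R) :
  mutually_independent X -> (forall i, measurable (B i)) ->
  forall D : set (R * R), measurable D ->
  let E := \bigcap_(i in [set: 'I_n]) X (lift ord0 (lift ord0 i)) @^-1` B i in
  P ([set w | D (X (lift ord0 ord0) w, X ord0 w)] `&` E) =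
  ((distribution P (X (lift ord0 ord0)) \x distribution P (X ord0)) D *
   \prod_(i < n) P (X (lift ord0 (lift ord0 i)) @^-1` B i))%E.
Proof.
move=> indX mB D mD E.
have rect A1 A0 : measurable A1 -> measurable A0 ->
    P ((X (lift ord0 ord0) @^-1` A1 `&` X ord0 @^-1` A0) `&` E) =
    (P (X (lift ord0 ord0) @^-1` A1) * P (X ord0 @^-1` A0) *
     \prod_(i < n) P (X (lift ord0 (lift ord0 i)) @^-1` B i))%E.
  move=> mA1 mA0.
  (* The family is [A0] at index 0, [A1] at index 1 and [B k] at index k + 2. *)
  pose C (i : 'I_n.+2) := if unlift ord0 i is Some j then
    if unlift ord0 j is Some k then B k else A1 else A0.
  have mC i : measurable (C i).
    by rewrite /C; case: unlift => // j; case: unlift.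
  have := indX C mC.
  rewrite !big_ord_recl !bigcap_ord_recl /C unlift_none liftK unlift_none.
  under eq_bigcapr do rewrite !liftK.
  under eq_bigr do rewrite !liftK.
  rewrite setIA [X ord0 @^-1` _ `&` _]setIC => ->.
  by rewrite muleCA muleA.
have PE : P E = (\prod_(i < n) P (X (lift ord0 (lift ord0 i)) @^-1` B i))%E.
  have := rect setT setT measurableT measurableT.
  by rewrite !preimage_setT !setTI probability_setT !mul1e.
rewrite -PE; apply: joint_law_restr => //; last first.
  by move=> A1 A0 mA1 mA0; rewrite PE rect.
apply: fin_bigcap_measurable => // i _.
exact: measurable_funPTI.
Qed.

Lemma joint_law01 (d : measure_display) (T : measurableType d)
    (R : realType) (P : probability T R) (n : nat)
    (X : 'I_n.+2 -> {RV P >-> R}) :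
  mutually_independent X -> forall D : set (R * R), measurable D ->
  P [set w | D (X (lift ord0 ord0) w, X ord0 w)] =
  (distribution P (X (lift ord0 ord0)) \x distribution P (X ord0))%E D.
Proof.
move=> indX D mD.
have := @joint_law01_restr _ _ _ _ _ _ (fun=> setT) indX
  (fun=> measurableT) _ mD.
rewrite /= big1 ?mule1; last first.
  by move=> i _; rewrite preimage_setT probability_setT.
by move=> <-; congr (P _); apply/seteqP; split => w => [|[]].
Qed.

(** An event on [Y] is a planar event on the first two variables, so it still factors from the
    others. The induction that absorbs users one at a time rests on this. *)
Lemma mutually_independent_sub (d : measure_display) (T : measurableType d)
    (R : realType) (P : probability T R) (n : nat)
    (X : 'I_n.+2 -> {RV P >-> R}) (f : R -> R) (Y : {RV P >-> R}) :
  measurable_fun setT f ->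
  (forall w, Y w = X ord0 w - f (X (lift ord0 ord0) w)) ->
  mutually_independent X ->
  mutually_independent (fun i : 'I_n.+1 =>
    if unlift ord0 i is Some j then X (lift ord0 (lift ord0 j)) else Y).
Proof.
move=> mf YE indX B mB.
pose D := [set z : R * R | B ord0 (z.2 - f z.1)].
have mD : measurable D.
  rewrite -[X in measurable X]setTI.
  have mg : measurable_fun [set: R * R] (fun z => z.2 - f z.1).
    by apply: measurable_funB => //; exact: measurableT_comp.
  exact: mg.
have ED : Y @^-1` B ord0 = [set w | D (X (lift ord0 ord0) w, X ord0 w)].
  by apply/seteqP; split => w /=; rewrite YE.
have XD := @joint_law01_restr _ _ _ _ _ _ (fun i => B (lift ord0 i)) indX.
rewrite bigcap_ord_recl big_ord_recl unlift_none.
under eq_bigcapr do rewrite liftK.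
under eq_bigr do rewrite liftK.
rewrite ED XD//; congr (_ * _)%E.
by rewrite (joint_law01 indX).
Qed.

(** * Absorbing independent variables into an exponential tail *)

(** For a fixed value x of the second variable the tail at [t + f x] is [K] times e^(-t) e^(-f(x));
    integrating over its law gives the expectation. Nonnegativity of [f] keeps the shifted level in
    the range of the tail hypothesis. *)
Lemma independent_tail_shift (d : measure_display) (T : measurableType d)
    (R : realType) (P : probability T R) (n : nat)
    (X : 'I_n.+2 -> {RV P >-> R}) (f : R -> R) (K : \bar R) :
  measurable_fun setT f -> (forall x, 0 <= f x) -> mutually_independent X ->
  (forall t : R, (0 <= t)%R ->
    P [set w | (t <= X ord0 w)%R] = K * (expR (- t))%:E)%E ->
  forall t : R, 0 <= t ->
  (P [set w | (t + f (X (lift ord0 ord0) w) <= X ord0 w)%R] =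
   K * 'E_P[fun w => expR (- f (X (lift ord0 ord0) w))] * (expR (- t))%:E)%E.
Proof.
move=> mf f0 indX XK t t0.
pose D := [set z : R * R | t + f z.1 <= z.2].
have mD : measurable D.
  rewrite -[X in measurable X]setTI; apply: measurable_fun_le => //.
  by apply: measurable_funD => //; exact: measurableT_comp.
rewrite (joint_law01 indX mD) /product_measure1.
have K0 : (0 <= K)%E.
  by have := XK 0 (lexx _); rewrite oppr0 expR0 mule1 => <-.
rewrite (eq_integral
  (fun x => (K * (expR (- t))%:E) * (expR (- f x))%:E)%E); last first.
  move=> x _ /=; rewrite -muleA -EFinM -expRD -opprD -XK ?addr_ge0//.
  by congr (P _); apply/seteqP; split => w /=; rewrite /xsection/= inE.
have mef : measurable_fun setT (fun x => (expR (- f x))%:E).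
  apply/measurable_EFinP; apply: measurableT_comp => //.
  exact: measurable_funN.
rewrite ge0_integralZl//; last by rewrite mule_ge0// lee_fin expR_ge0.
rewrite ge0_integral_distribution//.
by rewrite unlock muleAC.
Qed.

(** The induction replaces the first variable by a difference that may be negative and is no longer
    exponential. Only the shape of its tail on nonnegative levels survives, with a new constant,
    hence the general [K]. *)
Lemma tail_sub_sum (d : measure_display) (T : measurableType d)
    (R : realType) (P : probability T R) (n : nat)
    (X : 'I_n.+1 -> {RV P >-> R}) (f : 'I_n -> R -> R) (K : \bar R) :
  (forall i, measurable_fun setT (f i)) -> (forall i x, 0 <= f i x) ->
  mutually_independent X ->
  (forall t : R, (0 <= t)%R ->
    P [set w | (t <= X ord0 w)%R] = K * (expR (- t))%:E)%E ->
  forall t : R, 0 <= t ->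
  (P [set w | (t + \sum_(i < n) f i (X (lift ord0 i) w) <= X ord0 w)%R] =
   K * \prod_(i < n) 'E_P[fun w => expR (- f i (X (lift ord0 i) w))]
     * (expR (- t))%:E)%E.
Proof.
elim: n X f K => [|n IH] X f K mf f0 indX XK t t0.
  rewrite big_ord0 mule1 -XK//; congr (P _).
  by apply/seteqP; split => w /=; rewrite big_ord0 addr0.
have mY : measurable_fun setT
    (fun w => X ord0 w - f ord0 (X (lift ord0 ord0) w)).
  by apply: measurable_funB => //; exact: measurableT_comp.
pose mY' := isMeasurableFun.Build _ _ _ _ _ mY.
pose Y : {RV P >-> R} := HB.pack
  (fun w => X ord0 w - f ord0 (X (lift ord0 ord0) w)) mY'.
have indY := mutually_independent_sub (mf ord0) (fun w => erefl (Y w)) indX.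
have := IH _ (fun i => f (lift ord0 i)) _ _ _ indY _ t t0.
move=> /(_ (K * 'E_P[fun w => expR (- f ord0 (X (lift ord0 ord0) w))])%E).
rewrite unlift_none => IHY.
transitivity (P [set w | t + \sum_(i < n) f (lift ord0 i)
   ((if unlift ord0 (lift ord0 i) is Some j
     then X (lift ord0 (lift ord0 j)) else Y) w) <= Y w]).
  congr (P _); apply/funext => w /=; rewrite lerBrDr big_ord_recl addrCA addrC.
  by congr (is_true (_ + _ + _ <= _)); apply: eq_bigr => i _; rewrite liftK.
rewrite IHY//; last first.
  move=> s s0; rewrite -(independent_tail_shift _ (f0 ord0) indX)//.
  by congr (P _); apply/seteqP; split => w /=; rewrite lerBrDr.
rewrite big_ord_recl muleA; congr (_ * _ * _)%E.
by apply: eq_bigr => i _; rewrite liftK.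
Qed.

(** * Exponential densities and the truncated Laplace transform *)

(** The Radon-Nikodym derivative of [nu] and [p] have equal integrals over every measurable set, so
    they agree almost everywhere. *)
Lemma ge0_integral_density (d : measure_display) (T : measurableType d)
    (R : realType) (mu : {sigma_finite_measure set T -> \bar R})
    (nu : {finite_measure set T -> \bar R}) (p : T -> R) (f : T -> \bar R) :
  measurable_fun setT p ->
  (forall A, measurable A -> nu A = \int[mu]_(x in A) (p x)%:E)%E ->
  measurable_fun setT f -> (forall x, 0 <= f x)%E ->
  (\int[nu]_x f x = \int[mu]_x (f x * (p x)%:E))%E.
Proof.
move=> mp nuE mf f0.
have numu : nu `<< mu.
  apply/null_content_dominatesP => A mA A0.
  rewrite nuE// null_set_integral//.
  by apply/measurable_EFinP; exact: measurable_funTS.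
rewrite -(Radon_Nikodym_SigmaFinite.change_of_variables numu)//.
have ig := Radon_Nikodym_SigmaFinite.f_integrable numu.
have mg := measurable_int _ ig.
apply: ae_eq_integral => //.
- exact: emeasurable_funM.
- by apply: emeasurable_funM => //; exact/measurable_EFinP.
apply: ae_eqe_mul2l; apply: integral_ae_eq => //.
- exact/measurable_EFinP.
- move=> A _ mA; rewrite -nuE//.
  by rewrite -Radon_Nikodym_SigmaFinite.f_integral.
Qed.

Lemma exponential_prob_itvNyo (R : realType) (r t : R) : 0 < r -> 0 <= t ->
  exponential_prob r `]-oo, t[ = (1 - expR (- r * t))%:E.
Proof.
move=> r0 t0; have mp := measurable_exponential_pdf r.
transitivity (exponential_prob r (`]-oo, t[ `&` `[0, +oo[)).
  rewrite /exponential_prob [RHS]integral_mkcondr; apply: eq_integral => x _.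
  rewrite patchE; case: ifPn => //; rewrite notin_setE/= in_itv/= andbT.
  by move/negP; rewrite -ltNge => x0; rewrite lt0_exponential_pdf.
have -> : `]-oo, t[%classic `&` `[0, +oo[%classic = `[0, t[%classic :> set R.
  by apply/seteqP; split => x /=; rewrite !in_itv/= andbT;
    [case=> -> -> | case/andP].
rewrite /exponential_prob integral_itv_bndo_bndc; last first.
  by apply/measurable_EFinP; exact: measurable_funTS.
have [->|t_gt0] := eqVneq t 0.
  by rewrite set_itv1 integral_set1 mulr0 expR0 subrr.
by apply: exponential_prob_itv0c; rewrite lt_neqAle eq_sym t_gt0.
Qed.

Lemma exponential_prob_itvcy (R : realType) (r t : R) : 0 < r -> 0 <= t ->
  exponential_prob r `[t, +oo[ = (expR (- r * t))%:E.
Proof.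
move=> r0 t0; have mp := measurable_exponential_pdf r.
have : (exponential_prob r `]-oo, t[ + exponential_prob r `[t, +oo[ = 1)%E.
  rewrite -(integral_exponential_pdf r0) -(setUv `]-oo, t[) setCitvl.
  rewrite ge0_integral_setU//.
  - exact/measurable_EFinP/measurable_funTS.
  - by move=> x _; rewrite lee_fin exponential_pdf_ge0// ltW.
  - by rewrite -setCitvl; exact/disj_setPCl.
rewrite exponential_prob_itvNyo//.
case: (exponential_prob r `[t, +oo[) => // x [] xE; congr EFin; lra.
Qed.

Lemma measurable_fun_truncated_linear (R : realType) (c tau : R) :
  measurable_fun setT (fun x : R => if 0 <= x < tau then c * x else 0).
Proof.
apply: measurable_fun_ifT => //.
by apply: measurable_and; [exact: measurable_fun_ler|exact: measurable_fun_ltr].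
Qed.

(* Multiplying by [expR (- c * x)] tilts the density of rate [1] to [1 + c]. *)
Lemma exponential_truncated_laplace (R : realType) (c tau : R) :
  0 <= c -> 0 < tau ->
  (\int[lebesgue_measure]_x
    ((expR (- (if 0 <= x < tau then c * x else 0)))%:E *
     (exponential_pdf 1 x)%:E))%E =
  ((1 - expR (- (1 + c) * tau)) / (1 + c) + expR (- tau))%:E.
Proof.
move=> c0 tau0; have c1 : 0 < 1 + c by rewrite ltr_wpDr.
have mp r := measurable_exponential_pdf r.
pose g x : \bar R := ((expR (- (if 0 <= x < tau then c * x else 0)))%:E *
  (exponential_pdf 1 x)%:E)%E.
(* For negative x both densities are 0, so the formula holds on the whole half-line below [tau]. *)
have gE1 x : x < tau ->
    g x = ((1 + c)^-1%:E * (exponential_pdf (1 + c) x)%:E)%E.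
  rewrite /g => xtau; rewrite xtau andbT -!EFinM; congr EFin.
  have [x0|x0] := leP 0 x; last by rewrite !lt0_exponential_pdf// !mulr0.
  rewrite !exponential_pdfE// mul1r -expRD mulKf ?gt_eqF//; congr expR; ring.
have gE2 x : tau <= x -> g x = (exponential_pdf 1 x)%:E.
  by rewrite /g => xtau; rewrite [x < _]ltNge xtau andbF oppr0 expR0 mul1e.
have mg : measurable_fun setT g.
  apply: emeasurable_funM; last by apply/measurable_EFinP; exact: mp.
  apply/measurable_EFinP; apply: measurableT_comp => //.
  by apply: measurable_funN; exact: measurable_fun_truncated_linear.
rewrite -/g -(setUv `]-oo, tau[) setCitvl ge0_integral_setU//; last 3 first.
- exact: measurable_funTS.
- move=> x _; rewrite /g mule_ge0// lee_fin ?expR_ge0//.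
  exact: exponential_pdf_ge0.
- by rewrite -setCitvl; exact/disj_setPCl.
transitivity ((1 + c)^-1%:E * exponential_prob (1 + c) `]-oo, tau[ +
              exponential_prob 1 `[tau, +oo[)%E; last first.
  rewrite exponential_prob_itvNyo ?ltW// exponential_prob_itvcy ?ltW//.
  by rewrite -EFinM -EFinD mulN1r [X in X + _]mulrC.
congr (_ + _)%E; last first.
  by apply: eq_integral => x; rewrite inE/= in_itv/= andbT => /gE2.
rewrite -ge0_integralZl//=.
- by apply: eq_integral => x; rewrite inE/= in_itv/= => /gE1.
- by apply/measurable_EFinP; apply: measurable_funTS; exact: mp.
- by move=> x _; rewrite lee_fin exponential_pdf_ge0// ltW.
- by rewrite lee_fin invr_ge0 ltW.
Qed.

(** * The algebra of the double sum *)

Lemma sum_geometric_inv (F : fieldType) (c : F) (n : nat) : 1 + c != 0 ->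
  \sum_(0 <= l < n) c / (1 + c) ^+ l.+1 = 1 - ((1 + c) ^+ n)^-1.
Proof.
move=> c1; elim: n => [|n IH]; first by rewrite big_geq// expr0 invr1 subrr.
rewrite big_nat_recr//= IH exprS; field.
by rewrite c1 expf_neq0.
Qed.

Lemma binomial_alternating (F : comNzRingType) (x : F) (n : nat) :
  \sum_(0 <= p < n.+1) 'C(n, p)%:R * (-1) ^+ p * x ^+ p = (1 - x) ^+ n.
Proof.
rewrite big_mkord exprDn; apply: eq_bigr => p _.
by rewrite expr1n mul1r [(- x) ^+ _]exprNn -[RHS]mulr_natl mulrA.
Qed.

(** Used with x = e^(-tau), w = e^(-c tau), k = e^(-a). The geometric sum over l leaves k - k w^p /
    (1 + c)^n; the alternating sum over p then yields n-th powers of 1 - x and [s], and the sum over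
    n is a difference of two binomial expansions. *)
Lemma outage_double_sum (F : fieldType) (M : nat) (c x w k : F) :
  1 + c != 0 -> 1 - x != 0 ->
  \sum_(1 <= n < M.+1) 'C(M, n)%:R * x ^+ (M - n) * (1 - x) ^+ n *
    \sum_(0 <= p < n.+1)
      ('C(n, p)%:R * (-1) ^+ p * x ^+ p / (1 - x) ^+ n *
       (\sum_(0 <= l < n) (c * (k * w ^+ p) / (1 + c) ^+ l.+1)
        + k - k * w ^+ p)) =
  k - k * ((1 - x * w) / (1 + c) + x) ^+ M.
Proof.
move=> c1 x1; pose s := (1 - x * w) / (1 + c).
have innerE n : \sum_(0 <= p < n.+1)
      ('C(n, p)%:R * (-1) ^+ p * x ^+ p / (1 - x) ^+ n *
       (\sum_(0 <= l < n) (c * (k * w ^+ p) / (1 + c) ^+ l.+1)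
        + k - k * w ^+ p)) =
    k * ((1 - x) ^+ n - s ^+ n) / (1 - x) ^+ n.
  transitivity (\sum_(0 <= p < n.+1)
      (k / (1 - x) ^+ n * ('C(n, p)%:R * (-1) ^+ p * x ^+ p) -
       k / (1 - x) ^+ n / (1 + c) ^+ n *
         ('C(n, p)%:R * (-1) ^+ p * (x * w) ^+ p))).
    apply: eq_bigr => p _.
    rewrite (eq_bigr (fun l => k * w ^+ p * (c / (1 + c) ^+ l.+1))); last first.
      by move=> l _; rewrite [c * _]mulrC -[LHS]mulrA.
    rewrite -mulr_sumr sum_geometric_inv// exprMn; field.
    by apply/andP; split; exact: expf_neq0.
  rewrite sumrB -!mulr_sumr !binomial_alternating /s expr_div_n; field.
  by apply/andP; split; exact: expf_neq0.
under eq_bigr do rewrite innerE.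
(* The term n = 0 is zero, so adding it completes both binomial expansions. *)
transitivity (\sum_(0 <= n < M.+1)
    k * (x ^+ (M - n) * (1 - x) ^+ n *+ 'C(M, n) -
         x ^+ (M - n) * s ^+ n *+ 'C(M, n))).
  rewrite [RHS]big_ltn// !expr0 subrr mulr0 add0r.
  apply: eq_bigr => n _; rewrite -mulrnBl -[X in _ = k * X]mulr_natl; field.
  exact: expf_neq0.
rewrite -mulr_sumr sumrB !big_mkord -!exprDn.
by rewrite [x + (1 - x)]addrC subrK expr1n mulrBr mulr1 [x + s]addrC.
Qed.

(** * Transfer to random variables, null events and measurability *)

Lemma ae_measure_eq (d : measure_display) (T : measurableType d)
    (R : realType) (mu : {measure set T -> \bar R}) (A B : set T) :
  measurable A -> measurable B -> (\forall x \ae mu, A x <-> B x) ->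
  mu A = mu B.
Proof.
move=> mA mB AB; rewrite -[A]setIT -[B]setIT -!integral_indic//.
apply: ge0_ae_eq_integral => //; [exact/measurable_EFinP..|].
apply: filterS AB => x AB _; congr (_%:R%:E).
by rewrite (_ : (x \in A) = (x \in B))//; apply/idP/idP; rewrite !inE => /AB.
Qed.

Lemma exponential_rv_tail (d : measure_display) (T : measurableType d)
    (R : realType) (P : probability T R) (X : {RV P >-> R}) (t : R) :
  (forall A, measurable A -> distribution P X A = exponential_prob 1 A) ->
  0 <= t -> P [set w | t <= X w] = (expR (- t))%:E.
Proof.
move=> PX t0; rewrite -mulN1r -exponential_prob_itvcy// -PX//.
by congr (P _); apply/seteqP; split => w /=; rewrite in_itv/= andbT.
Qed.

Lemma exponential_rv_ge0 (d : measure_display) (T : measurableType d)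
    (R : realType) (P : probability T R) (X : {RV P >-> R}) :
  (forall A, measurable A -> distribution P X A = exponential_prob 1 A) ->
  \forall w \ae P, 0 <= X w.
Proof.
move=> PX; exists (X @^-1` `]-oo, 0[); split.
- exact: measurable_funPTI.
- have := PX `]-oo, 0[%classic (measurable_itv _).
  by rewrite exponential_prob_itvNyo// mulr0 expR0 subrr.
- by move=> w /=; rewrite in_itv/= => /negP; rewrite -ltNge.
Qed.

Lemma exponential_rv_truncated_laplace (d : measure_display)
    (T : measurableType d) (R : realType) (P : probability T R)
    (X : {RV P >-> R}) (c tau : R) :
  (forall A, measurable A -> distribution P X A = exponential_prob 1 A) ->
  0 <= c -> 0 < tau ->
  'E_P[fun w => (expR (- (if 0 <= X w < tau then c * X w else 0)))%R]%E =
  ((1 - expR (- (1 + c) * tau)) / (1 + c) + expR (- tau))%:E.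
Proof.
move=> PX c0 tau0; rewrite -(exponential_truncated_laplace c0 tau0) unlock.
(* [R] and [measurableTypeR R] carry the same measurable sets but different
   displays; [lebesgue_measure] lives on the latter. *)
have mX : measurable_fun [set: T] (X : T -> measurableTypeR R).
  exact: (@measurable_funPT _ _ T R X).
pose mX' := isMeasurableFun.Build _ _ _ _ _ mX.
pose X' : {mfun T >-> measurableTypeR R} :=
  HB.pack (X : T -> measurableTypeR R) mX'.
pose f (x : measurableTypeR R) : \bar R :=
  (expR (- (if 0 <= x < tau then c * x else 0)))%:E.
have mf : measurable_fun setT f.
  apply/measurable_EFinP; apply: measurableT_comp => //.
  by apply: measurable_funN; exact: measurable_fun_truncated_linear.
have f0 x : (0 <= f x)%E by rewrite lee_fin expR_ge0.
transitivity (\int[distribution P X']_x f x)%E.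
  by rewrite ge0_integral_distribution.
apply: (@ge0_integral_density _ _ _ (@lebesgue_measure R)
  (distribution P X') (exponential_pdf 1) f) => //.
exact: measurable_exponential_pdf.
Qed.

Lemma measurable_admitted_interference (d : measure_display)
    (T : measurableType d) (R : realType) (n : nat) (tau Pbar : R)
    (X : 'I_n -> T -> R) :
  (forall i, measurable_fun setT (X i)) ->
  measurable_fun setT (fun w => admitted_interference tau Pbar (X ^~ w)).
Proof.
move=> mX.
have -> : (fun w => admitted_interference tau Pbar (X ^~ w)) =
    (fun w => \sum_(i < n) if X i w < tau then X i w * Pbar else 0).
  by apply/funext => w; rewrite admitted_interferenceE big_mkcond.
apply: measurable_sum => i; apply: measurable_fun_ifT => //.
  exact: measurable_fun_ltr.
exact: measurable_funM.
Qed.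

Lemma measurable_outage (d : measure_display) (T : measurableType d)
    (R : realType) (X I : T -> R) (P0 R0 : R) :
  measurable_fun setT X -> measurable_fun setT I ->
  measurable [set w | log2 (1 + X w * P0 / (I w + 1)) < R0].
Proof.
move=> mX mI.
suff mL : measurable_fun setT (fun w => log2 (1 + X w * P0 / (I w + 1))).
  rewrite -[X in measurable X]setTI.
  exact: (measurable_fun_ltr mL (measurable_cst R0) measurableT
    (Y := [set true])).
apply: measurable_funM => //; apply: (measurableT_comp (@measurable_ln R)).
apply: measurable_funD => //; apply: measurable_funM.
  exact: measurable_funM.
apply: (measurableT_comp (@measurable_invr R)).
exact: measurable_funD.
Qed.

(* h ord0 = |h_0|^2 ; h (lift ord0 m) = |h_{m+1}|^2 for m : 'I_M *)
Theorem theorem1 (d : measure_display) (T : measurableType d) (R : realType)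
    (P : probability T R) (M : nat) (tau P0 Pbar R0 : R)
    (h : 'I_M.+1 -> {RV P >-> R}) :
  (1 <= M)%N -> 0 < tau -> 0 < P0 -> 0 < Pbar -> 0 < R0 ->
  mutually_independent h ->
  (forall i A, measurable A -> distribution P (h i) A = exponential_prob 1 A) ->
  let eps0 := 2 `^ R0 - 1 in
  let a := eps0 / P0 in
  P [set w | log2 (1 + h ord0 w * P0 /
                   (admitted_interference tau Pbar (fun m : 'I_M => h (lift ord0 m) w) + 1))
             < R0] =
  ((\sum_(1 <= n < M.+1)
      (M`!)%:R / ((n`!)%:R * ((M - n)`!)%:R) * expR (- ((M - n)%:R * tau))
      * (1 - expR (- tau)) ^+ n
      * \sum_(0 <= p < n.+1)
          ('C(n, p)%:R * (-1) ^+ p * expR (- (p%:R * tau)) / (1 - expR (- tau)) ^+ n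
           * (\sum_(0 <= l < n)
                (a * Pbar * expR (- (a * (1 + Pbar * p%:R * tau)))
                 / (1 + a * Pbar) ^+ l.+1)
              + expR (- a) - expR (- (a * (1 + Pbar * p%:R * tau))))))
   + (1 - expR (- a)))%:E.
Proof.
move=> _ tau0 P00 Pbar0 R00 indh hexp eps0 a.
have eps0_gt0 : 0 < eps0.
  by rewrite subr_gt0 /powR pnatr_eq0/= expR_gt1 mulr_gt0// ln_gt0// ltr1n.
have a0 : 0 < a by rewrite divr_gt0.
pose I w := admitted_interference tau Pbar (fun m : 'I_M => h (lift ord0 m) w).
pose c := a * Pbar; have c0 : 0 < c by rewrite mulr_gt0.
(* Cutting off at 0 as well makes f nonnegative everywhere and only changes a
   null event. *)
pose f (x : R) := if 0 <= x < tau then c * x else 0.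
have f0 x : 0 <= f x.
  by rewrite /f; case: ifPn => // /andP[x0 _]; rewrite mulr_ge0// ltW.
have mf : measurable_fun setT f by exact: measurable_fun_truncated_linear.
pose tail := [set w | a + \sum_(i < M) f (h (lift ord0 i) w) <= h ord0 w].
have mtail : measurable tail.
  rewrite -[tail]setTI; apply: measurable_fun_le => //.
  apply: measurable_funD => //; apply: measurable_sum => i.
  exact: measurableT_comp.
have Ptail : P tail = (expR (- a) *
    ((1 - expR (- (1 + c) * tau)) / (1 + c) + expR (- tau)) ^+ M)%:E.
  (* The gain of the grant-based user has tail e^(-t), so the absorption starts from the constant 1
     and is evaluated at level [a]. *)
  have := tail_sub_sum (f := fun=> f) (K := 1%E) (fun=> mf) (fun=> f0) indh _
    (ltW a0).
  rewrite /tail => ->; last first.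
    by move=> t t0; rewrite mul1e; exact: exponential_rv_tail (hexp ord0) t0.
  rewrite mul1e (eq_bigr (fun=> ((1 - expR (- (1 + c) * tau)) / (1 + c)
    + expR (- tau))%:E)); last first.
    move=> i _.
    exact: exponential_rv_truncated_laplace (hexp _) (ltW c0) tau0.
  by rewrite prodEFin prodr_const card_ord -EFinM mulrC.
have mA : measurable [set w | log2 (1 + h ord0 w * P0 / (I w + 1)) < R0].
  apply: measurable_outage => //.
  by apply: measurable_admitted_interference => i.
(* Outage and the complement of [tail] coincide wherever all gains are nonnegative, which is almost
   everywhere. *)
transitivity (P (~` tail)).
  apply: (ae_measure_eq mA (measurableC mtail)).
  have h0 : \forall w \ae P, forall i, 0 <= h i w.
    by apply: filter_forall => i; exact: exponential_rv_ge0 (hexp i).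
  apply: filterS h0 => w h0 /=.
  have IE : I w =
      \sum_(i < M | h (lift ord0 i) w < tau) h (lift ord0 i) w * Pbar.
    by rewrite /I admitted_interferenceE.
  have I0 : 0 <= I w.
    by rewrite IE sumr_ge0// => i _; rewrite mulr_ge0 ?h0// ltW.
  rewrite log2_snr_lt// ltNge /tail/=.
  have -> : a * (I w + 1) = a + \sum_(i < M) f (h (lift ord0 i) w).
    rewrite mulrDr mulr1 addrC IE mulr_sumr big_mkcond/=; congr (_ + _).
    apply: eq_bigr => i _; rewrite /f h0/=; case: ifP => // _.
    by rewrite /c [RHS]mulrAC mulrA.
  by split => [/negP|] // /negP.
rewrite probability_setC// Ptail -EFinB; congr EFin.
(* The double sum collapses to k - k L^M with k = e^(-a); the separate summand 1 - k is the
   contribution of no interference, and the total is 1 - k L^M. *)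
rewrite [RHS](_ : _ = expR (- a) - expR (- a) *
  ((1 - expR (- tau) * expR (- (c * tau))) / (1 + c) + expR (- tau)) ^+ M
  + (1 - expR (- a))); last first.
  have c1 : 1 + c != 0 by rewrite gt_eqF// addr_gt0.
  have x1 : 1 - expR (- tau) != 0.
    by rewrite gt_eqF// subr_gt0 expR_lt1 oppr_lt0.
  congr (_ + _); rewrite -(outage_double_sum _ _ _ c1 x1).
  apply: eq_big_nat => n /andP[_ nM].
  congr (_ * _).
    congr (_ * _); congr (_ * _).
      rewrite -natrM -(bin_fact (n := M) (m := n))//.
      by rewrite natrM mulfK// pnatr_eq0 -lt0n muln_gt0 !fact_gt0.
    by rewrite -mulrN mulrC -expRM_natr.
  apply: eq_bigr => p _.
  have -> : expR (- (a * (1 + Pbar * p%:R * tau))) =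
      expR (- a) * expR (- (c * tau)) ^+ p.
    rewrite -expRM_natr -expRD; congr expR; rewrite /c.
    ring.
  by rewrite -mulrN expRM_natl.
have -> : expR (- (1 + c) * tau) = expR (- tau) * expR (- (c * tau)).
  by rewrite -expRD; congr expR; ring.
ring.
Qed.
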